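(* Let $\Gamma$ be a graph on a countable vertex set $\Omega$. The following three conditions are equivalent: (a) the neighbourhood filter $\mathcal{F}_\Gamma$ is non-trivial, that is, $\emptyset\notin\mathcal{F}_\Gamma$; (b) $\Gamma$ contains the Rado graph as a spanning subgraph, that is, there is a graph $R$ with vertex set $\Omega$, isomorphic to the Rado graph, such that every edge of $R$ is an edge of $\Gamma$; (c) there is a graph $R$ with vertex set $\Omega$, isomorphic to the Rado graph, such that $\mathcal{F}_\Gamma\subseteq\mathcal{F}_R$.
   Context: Graphs are simple and undirected (no loops, no multiple edges). For a graph $\Gamma$ with vertex set $\Omega$ and adjacency relation $\sim$, write $\Gamma(v)=\{w\in\Omega: v\sim w\}$ for the (open) neighbourhood of the vertex $v$. A filter on $\Omega$ is a collection of subsets of $\Omega$ closed upwards (under taking supersets) and closed under finite intersections; here it is allowed to contain the empty set, and it is called non-trivial if it does not contain the empty set. The filter generated by a collection $\mathcal{C}$ of subsets of $\Omega$ consists of all subsets of $\Omega$ containing a finite intersection of members of $\mathcal{C}$. The neighbourhood filter $\mathcal{F}_\Gamma$ is the filter on $\Omega$ generated by the sets $\Gamma(v)$, $v\in\Omega$. The Rado graph (the Erd\H{o}s--R\'enyi countable random graph) is the unique, up to isomorphism, countably infinite graph such that for any two disjoint finite sets $U,V$ of vertices there is a vertex $z\notin U\cup V$ adjacent to every vertex of $U$ and to no vertex of $V$. A spanning subgraph uses all vertices but need not be induced. *)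

(* Defs.v *)
From mathcomp Require Import all_boot finmap.
From mathcomp Require Import boolp classical_sets functions cardinality filter.

Set Implicit Arguments.
Unset Strict Implicit.
Unset Printing Implicit Defensive.

Local Open Scope classical_set_scope.

Record sgraph (V : Type) := SGraph {
  adj :> rel V;
  adj_sym : symmetric adj;
  adj_irrefl : irreflexive adj
}.

Definition nbhd (V : Type) (G : sgraph V) (v : V) : set V := [set w | G v w].

(* [finI_from] includes the empty intersection, so the filter always contains
   [setT]; on the empty vertex set it therefore contains the empty set. *)
Definition nbhd_filter (V : choiceType) (G : sgraph V) : set_system V :=
  filter_from (finI_from [set: V] (nbhd G)) id.

Definition nontrivial_filter (V : Type) (F : set_system V) : Prop := ~ F set0.

Definition graph_iso (V W : Type) (G : sgraph V) (H : sgraph W) : Prop :=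
  exists f : V -> W, bijective f /\ {mono f : x y / G x y >-> H x y}.

Definition spanning_subgraph (V : Type) (R G : sgraph V) : Prop := subrel R G.

Definition is_rado (V : choiceType) (G : sgraph V) : Prop :=
  ([set: V] #= [set: nat])%card /\
  forall A B : {fset V}, [disjoint A & B]%fset ->
    exists z : V, [/\ z \notin (A `|` B)%fset,
      {in A, forall a, G z a} & {in B, forall b, ~~ G z b}].

Lemma nbhd_filter_filter (V : choiceType) (G : sgraph V) :
  Filter (nbhd_filter G).
Proof.
apply: filter_from_filter; first by exists setT; exists fset0 => //=;
  apply/seteqP; split.
move=> _ _ [A _ <-] [B _ <-].
exists (\bigcap_(i in [set` (A `|` B)%fset]) nbhd G i).
  by exists (A `|` B)%fset => // x _; rewrite in_setT.
by move=> x xAB; split=> i /= iAB; apply: xAB; rewrite /= in_fsetU iAB ?orbT.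
Qed.

(* Existence of a Rado graph on [nat]: for i < j, i and j are joined iff i
   belongs to the j-th finite sequence, in an enumeration of seq nat in which
   every sequence recurs infinitely often. *)
Section RadoExists.

Let code (s : seq nat) (m : nat) : nat := choice.pickle (s, m).
Let dec (j : nat) : seq nat :=
  if (choice.unpickle j : option (seq nat * nat)) is Some p then p.1 else [::].
Let e (i j : nat) : bool :=
  (i < j) && (i \in dec j) || (j < i) && (j \in dec i).

Let e_sym : symmetric e. Proof. by move=> i j; rewrite /e orbC. Qed.
Let e_irrefl : irreflexive e. Proof. by move=> i; rewrite /e ltnn. Qed.

Let code_unbounded s b : exists m, b < code s m.
Proof.
apply: contrapT => /forallNP H.
have codeI : injective (code s) by move=> x y /(pcan_inj choice.pickleK) [].
have : size (map (code s) (iota 0 b.+2)) <= size (iota 0 b.+1).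
  apply: uniq_leq_size; first by rewrite map_inj_uniq ?iota_uniq.
  move=> _ /mapP[m _ ->]; rewrite mem_iota /= add0n ltnS leqNgt.
  by apply/negP; apply: H.
by rewrite size_map !size_iota ltnn.
Qed.

Lemma rado_exists : exists R : sgraph nat, is_rado R.
Proof.
exists (SGraph e_sym e_irrefl); split; first exact: card_eqxx.
move=> A B /fdisjointP AB.
have [m hm] := code_unbounded A (\max_(i <- (A `|` B)%fset) i).
have lt i : i \in (A `|` B)%fset -> i < code A m.
  by move=> iAB; apply: leq_ltn_trans hm; rewrite (big_rem i) //= leq_maxl.
have decE : dec (code A m) = A by rewrite /dec /code choice.pickleK.
exists (code A m); split.
- by apply/negP => /lt; rewrite ltnn.
- move=> a aA /=; have la : a < code A m by apply: lt; rewrite in_fsetU aA.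
  by rewrite /e decE la (aA : a \in enum_fset A) orbT.
- move=> b bB /=; have lb : b < code A m by apply: lt; rewrite in_fsetU bB orbT.
  rewrite /e decE lb ltnNge (ltnW lb) /=.
  by apply/negP => bA; move: (AB b bA); rewrite bB.
Qed.

End RadoExists.

(* The Rado graph is determined only up to isomorphism; this is a chosen
   representative, specified by [rado_is_rado]. *)
Definition rado : sgraph nat := sval (cid rado_exists).

Lemma rado_is_rado : is_rado rado. Proof. exact: svalP (cid rado_exists). Qed.

(* Main.v *)
Require Import Defs.
From mathcomp Require Import all_boot finmap.
From mathcomp Require Import boolp classical_sets functions cardinality filter.

(** Nontriviality of the neighbourhood filter says that every finite set of
    vertices has a common neighbour, which is new since there are no loops.
    Dually, every finite set of vertices of the Rado graph misses, and is not
    adjacent to, some vertex.  Hence in a back-and-forth construction a partial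
    injection from the Rado graph to Gamma preserving edges (but not
    necessarily non-edges) extends in both directions: a vertex of the Rado
    graph goes to a common neighbour of the image, and a vertex of Gamma is the
    image of a vertex with no neighbour in the domain. *)

Local Open Scope classical_set_scope.

(** A finite intersection of neighbourhoods is the set of common neighbours of a finite set, and the
    filter contains [set0] exactly when one such intersection is empty. *)
Lemma nontrivial_nbhd_filterP (V : choiceType) (G : sgraph V) :
  nontrivial_filter (nbhd_filter G) <->
  forall s : seq V, exists z, {in s, forall x, G z x}.
Proof.
split=> [nt s | common].
  apply: contrapT => none; apply: nt.
  exists (\bigcap_(x in [set` [fset x in s]%fset]) nbhd G x).
    by exists [fset x in s]%fset => // x _; rewrite in_setT.
  move=> z zs; apply: none; exists z => x xs.
  by rewrite adj_sym; apply: zs; rewrite /= inE.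
case=> _ [A _ <-] A0; have [z zA] := common A.
by apply: (A0 z) => x xA; rewrite /nbhd /= adj_sym zA.
Qed.

(** Deleting edges shrinks every neighbourhood, hence every finite intersection of them. *)
Lemma nbhd_filter_anti (V : choiceType) (R G : sgraph V) :
  spanning_subgraph R G -> nbhd_filter G `<=` nbhd_filter R.
Proof.
move=> RG X [_ [A _ <-] AX].
exists (\bigcap_(x in [set` A]) nbhd R x).
  by exists A => // x _; rewrite in_setT.
by move=> z zA; apply: AX => x xA; apply: RG; apply: zA.
Qed.

Lemma graph_iso_common_nbr (V W : choiceType) (R : sgraph V) (H : sgraph W) :
  graph_iso R H ->
  (forall s : seq W, exists z, {in s, forall x, H z x}) ->
  forall s : seq V, exists z, {in s, forall x, R z x}.
Proof.
move=> [f [[g fK gK] fM]] common s.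
have [z zs] := common (map f s); exists (g z) => x xs.
by rewrite -fM gK zs ?map_f.
Qed.

Lemma rado_common_nbr (s : seq nat) : exists z, {in s, forall x, rado z x}.
Proof.
have [_ ext] := rado_is_rado.
have [z [_ zs _]] := ext [fset x in s]%fset fset0 (fdisjointX0 _).
by exists z => x xs; apply: zs; rewrite inE.
Qed.

Lemma rado_common_nonnbr (s : seq nat) :
  exists2 z, z \notin s & {in s, forall x, ~~ rado z x}.
Proof.
have [_ ext] := rado_is_rado.
have [z [zs _ nzs]] := ext fset0 [fset x in s]%fset (fdisjoint0X _).
exists z => [|x xs]; first by rewrite fset0U inE in zs.
by apply: nzs; rewrite inE.
Qed.

Section BackAndForth.

Variables (V W : countType) (H : sgraph V) (G : sgraph W).
Hypothesis common_nonnbr :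
  forall s : seq V, exists2 z, z \notin s & {in s, forall x, ~~ H z x}.
Hypothesis common_nbr : forall s : seq W, exists z, {in s, forall x, G z x}.

(** The equality clause makes a set of pairs both functional and injective; the edge clause is
    one-way, so non-edges may become edges. *)
Definition compatible (p q : V * W) : bool :=
  ((p.1 == q.1) == (p.2 == q.2)) && (H p.1 q.1 ==> G p.2 q.2).

Definition partial_hom (s : seq (V * W)) : Prop :=
  {in s &, forall p q, compatible p q}.

Lemma compatible_sym : symmetric compatible.
Proof.
move=> p q; rewrite /compatible (eq_sym p.1) (eq_sym p.2).
by rewrite (adj_sym H p.1) (adj_sym G p.2).
Qed.

Lemma partial_hom_cons p s :
  partial_hom s -> {in s, forall q, compatible p q} -> partial_hom (p :: s).
Proof.
move=> homs ps x y; rewrite !inE => /predU1P[->|xs] /predU1P[->|ys].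
- by rewrite /compatible !eqxx adj_irrefl.
- exact: ps.
- by rewrite compatible_sym ps.
- exact: homs.
Qed.

Lemma partial_hom_forth s (v : V) : partial_hom s ->
  exists t, [/\ partial_hom t, {subset s <= t} & v \in map fst t].
Proof.
move=> homs; have [vs|vs] := boolP (v \in map fst s); first by exists s; split.
have [w ws] := common_nbr (map snd s).
exists ((v, w) :: s); split; last by rewrite inE eqxx.
  apply: partial_hom_cons => // q qs; have wq := ws _ (map_f snd qs).
  rewrite /compatible /= wq implybT andbT.
  have /negPf-> : v != q.1 by apply: contraNneq vs => ->; rewrite map_f.
  (* The new image is distinct from the old ones because it is adjacent to them and [G] has no
     loops. *)
  by case: (eqVneq w q.2) wq => // ->; rewrite adj_irrefl.
by move=> q qs; rewrite inE qs orbT.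
Qed.

Lemma partial_hom_back s (w : W) : partial_hom s ->
  exists t, [/\ partial_hom t, {subset s <= t} & w \in map snd t].
Proof.
move=> homs; have [ws|ws] := boolP (w \in map snd s); first by exists s; split.
have [v vs nv] := common_nonnbr (map fst s).
exists ((v, w) :: s); split; last by rewrite inE eqxx.
  apply: partial_hom_cons => // q qs.
  (* With no edge from [v] into the domain, the edge clause is vacuous. *)
  rewrite /compatible /= (negPf (nv _ (map_f fst qs))) andbT.
  have /negPf-> : v != q.1 by apply: contraNneq vs => ->; rewrite map_f.
  by have /negPf-> : w != q.2 by apply: contraNneq ws => ->; rewrite map_f.
by move=> q qs; rewrite inE qs orbT.
Qed.

(** One stage goes forth and back, treating the vertices of code [n], if any, on both sides. The
    sigma type lets [choice] turn it into a total step function. *)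
Lemma partial_hom_step (s : {s | partial_hom s}) (n : nat) :
  exists t : {s | partial_hom s},
    [/\ {subset sval s <= sval t},
        forall v, choice.unpickle n = Some v -> v \in map fst (sval t) &
        forall w, choice.unpickle n = Some w -> w \in map snd (sval t)].
Proof.
case: s => s homs.
have [t [homt st tv]] : exists t, [/\ partial_hom t, {subset s <= t} &
    forall v, choice.unpickle n = Some v -> v \in map fst t].
  case: (choice.unpickle n) => [v|]; last by exists s; split.
  have [t [homt st vt]] := partial_hom_forth _ v homs.
  by exists t; split=> // _ [<-].
have [u [homu tu uw]] : exists u, [/\ partial_hom u, {subset t <= u} &
    forall w, choice.unpickle n = Some w -> w \in map snd u].
  case: (choice.unpickle n) => [w|]; last by exists t; split.
  have [u [homu tu wu]] := partial_hom_back _ w homt.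
  by exists u; split=> // _ [<-].
exists (exist _ u homu); split=> //= [p /st/tu //|v /tv /mapP[p pt ->]].
by rewrite map_f ?tu.
Qed.

Lemma bijective_hom : exists f : V -> W,
  bijective f /\ {homo f : x y / H x y >-> G x y}.
Proof.
have [next nextP] := choice (fun sn => partial_hom_step sn.1 sn.2).
have hom0 : partial_hom [::] by [].
pose S := fix S n := if n is m.+1 then next (S m, m) else exist _ [::] hom0.
have S_mono : {homo S : m n / m <= n >-> {subset sval m <= sval n}}.
  apply: homo_leq => [s //|t s u st tu p /st/tu //|n].
  by have [] := nextP (S n, n).
pose F v w := exists n, (v, w) \in sval (S n).
(* The stages increase, so any two pairs of the union occur in a common one. *)
have F_compat v w v' w' : F v w -> F v' w' -> compatible (v, w) (v', w').
  move=> [m Sm] [n Sn]; apply: (svalP (S (maxn m n))).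
    exact: S_mono (leq_maxl m n) _ Sm.
  exact: S_mono (leq_maxr m n) _ Sn.
have /choice[f fP] : forall v, exists w, F v w.
  move=> v; pose n := choice.pickle v.
  have [_ /(_ v (choice.pickleK v)) /mapP[[x w] p ->] _] := nextP (S n, n).
  by exists w, n.+1.
have /choice[g gP] : forall w, exists v, F v w.
  move=> w; pose n := choice.pickle w.
  have [_ _ /(_ w (choice.pickleK w)) /mapP[[v x] p ->]] := nextP (S n, n).
  by exists v, n.+1.
exists f; split; last first.
  by move=> x y xy; have /andP[_ /implyP] := F_compat _ _ _ _ (fP x) (fP y); apply.
(* Two pairs of [F] sharing one coordinate share the other, so [f] and [g] are mutually inverse. *)
exists g => [v|w]; apply/eqP.
  by have /andP[/eqP /= ->] := F_compat _ _ _ _ (gP (f v)) (fP v).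
by have /andP[/eqP /= <-] := F_compat _ _ _ _ (fP (g w)) (gP w).
Qed.

End BackAndForth.

Theorem theorem5p2 (Omega : countType) (Gamma : sgraph Omega) :
  [<-> nontrivial_filter (nbhd_filter Gamma);
       exists R : sgraph Omega, graph_iso R rado /\ spanning_subgraph R Gamma;
       exists R : sgraph Omega,
         graph_iso R rado /\ nbhd_filter Gamma `<=` nbhd_filter R].
Proof.
tfae.
- move=> /nontrivial_nbhd_filterP common.
  have [f [[g fK gK] f_hom]] :=
    bijective_hom _ _ _ _ rado_common_nonnbr common.
  (* The Rado graph is transported to [Omega] along the bijection, so [g] is an isomorphism by
     construction. *)
  pose e x y := rado (g x) (g y).
  have e_sym : symmetric e by move=> x y; rewrite /e adj_sym.
  have e_irrefl : irreflexive e by move=> x; rewrite /e adj_irrefl.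
  exists (SGraph e_sym e_irrefl); split; first by exists g; split=> //; exists f.
  by move=> x y /f_hom; rewrite !gK.
- by move=> [R [isoR RG]]; exists R; split=> //; apply: nbhd_filter_anti.
- move=> [R [isoR GR]] G0.
  (* The filter of [R] is non-trivial, and so is any smaller one. *)
  have /nontrivial_nbhd_filterP : forall s : seq Omega,
      exists z, {in s, forall x, R z x}.
    exact: graph_iso_common_nbr isoR rado_common_nbr.
  by apply; apply: GR.
Qed.
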